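(* Let $PG_n$ be the random pentagonal chain network described in the context, and assume Hypotheses 1 and 2 of the context hold. Then: (i) For $n\ge 1$, $$Var\big(S(PG_{n})\big)=\frac{1}{30}\Big(\sigma^{2}_{2}n^{5}-5r_{2}n^{4}+10\tilde{\sigma}^{2}_{2}n^{3}+(65r_{2}-30\sigma^{2}_{2}-45\tilde{\sigma}^{2}_{2})n^{2}+(59\sigma^{2}_{2}+65\tilde{\sigma}^{2}_{2}-120r_{2})n+(60r_{2}-30\sigma^{2}_{2}-30\tilde{\sigma}^{2}_{2})\Big),$$ where $\sigma^{2}_{2}=240^{2}p_{1}+360^{2}(1-p_{1})-\big(240p_{1}+360(1-p_{1})\big)^{2}$, $\tilde{\sigma}^{2}_{2}=113^{2}p_{1}+233^{2}(1-p_{1})-\big(113p_{1}+233(1-p_{1})\big)^{2}$, $r_{2}=240\cdot113\,p_{1}+360\cdot233\,(1-p_{1})-\big(240p_{1}+360(1-p_{1})\big)\big(113p_{1}+233(1-p_{1})\big)$. (ii) $S(PG_n)$ is asymptotically normal: $$\lim_{n\rightarrow \infty}\sup_{a\in \mathbb{R}}\Big| \mathbb{P}\Big(\frac{S(PG_{n})-\mathbb{E}\big(S(PG_{n})\big)}{\sqrt{Var\big(S(PG_{n})\big)}}\leq a\Big)-\int^{a}_{-\infty}\frac{1}{\sqrt{2\pi}}e^{-t^{2}/2}\,dt \Big| =0.$$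
   Context: Random chain network $PG_n$: $PG_1$ is a $5$-cycle (pentagon). For $n\ge 1$, $PG_{n+1}$ is obtained from $PG_n$ by adding a new pentagon $O_{n+1}$ with vertices $x_1,\dots,x_5$ in cyclic order and adding one edge joining $x_1$ to a vertex $u_n$ of $PG_n$. The vertex $u_1$ is any vertex of $PG_1$. For $n\ge 2$, $u_n$ is a vertex of the last pentagon $O_n$ (whose vertex $x_1$ is the one joined to $u_{n-1}$): either $u_n\in\{x_2,x_5\}$ of $O_n$ (neighbours of $x_1$ in $O_n$; set $Z_n^1=1$, $Z_n^2=0$) or $u_n\in\{x_3,x_4\}$ of $O_n$ (vertices at distance $2$ from $x_1$ in $O_n$; set $Z_n^1=0$, $Z_n^2=1$), with $\mathbb{P}(Z_n^1=1)=p_1$, $\mathbb{P}(Z_n^2=1)=p_2=1-p_1$, constants independent of $n$. Hypothesis 1: the random vectors $(Z_n^1,Z_n^2)$, $n=2,3,\dots$, are independent. Hypothesis 2: $0<p_i<1$ for $i=1,2$. For a graph $G$, $d(v)$ is the degree of $v$, $d(u,v)$ the shortest-path distance, and the Schultz index is $S(G)=\sum_{\{u,v\}\subseteq V_G} \big(d(u)+d(v)\big)\,d(u,v)$ over unordered pairs of distinct vertices. *)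

(* Defs.v *)
From HB Require Import structures.
From mathcomp Require Import all_boot all_order all_algebra.
From mathcomp Require Import all_classical all_reals all_analysis.
Set Implicit Arguments. Unset Strict Implicit. Unset Printing Implicit Defensive.
Import Order.TTheory GRing.Theory Num.Theory.

(* ---------- The pentagonal chain PG_n (deterministic part) ----------
   Vertices of PG_n are the naturals 0 .. 5n-1.  Pentagon O_(k+1)
   (k = 0 .. n-1) has vertices 5k + j, j = 0..4, where offset j stands for
   x_(j+1) (so offset 0 is x_1) in cyclic order.
   u : nat -> 'I_5 gives, for each m >= 1, the offset inside O_m of the
   vertex u_m; the edge x_1(O_(m+1)) -- u_m is present for m+1 <= n.      *)

Definition pg_link (u : nat -> 'I_5) (a b : nat) : bool :=
  [&& b %% 5 == 0, 0 < b %/ 5 & a == 5 * (b %/ 5).-1 + val (u (b %/ 5))]%N.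

Definition pg_adj (n : nat) (u : nat -> 'I_5) (a b : nat) : bool :=
  [&& a < 5 * n, b < 5 * n &
     [|| (a %/ 5 == b %/ 5) &&
           ((a %% 5 == (b %% 5).+1 %% 5) || (b %% 5 == (a %% 5).+1 %% 5)),
         pg_link u a b | pg_link u b a]]%N.

Definition pg_deg (n : nat) (u : nat -> 'I_5) (a : nat) : nat :=
  count (pg_adj n u a) (iota 0 (5 * n)).

Fixpoint pg_reach (n : nat) (u : nat -> 'I_5) (k a b : nat) : bool :=
  if k is k'.+1 then
    pg_reach n u k' a b || has (fun c => pg_reach n u k' a c && pg_adj n u c b)
                               (iota 0 (5 * n))
  else a == b.

(* shortest-path distance d(a,b): least k with a walk of length <= k
   (PG_n is connected with 5n vertices, so such k < 5n exists) *)
Definition pg_dist (n : nat) (u : nat -> 'I_5) (a b : nat) : nat :=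
  find (fun k => pg_reach n u k a b) (iota 0 (5 * n)).

Definition schultz (n : nat) (u : nat -> 'I_5) : nat :=
  (\sum_(0 <= a < 5 * n) \sum_(a.+1 <= b < 5 * n)
      (pg_deg n u a + pg_deg n u b) * pg_dist n u a b)%N.

Local Open Scope ring_scope.
Local Open Scope classical_set_scope.

Section Prob.
Context (R : realType) (d : measure_display) (T : measurableType d).

Definition Z1 (u : nat -> T -> 'I_5) (m : nat) (w : T) : bool :=
  (val (u m w) == 1%N) || (val (u m w) == 4%N).

Definition SPG (n : nat) (u : nat -> T -> 'I_5) (w : T) : R :=
  (schultz n (fun m => u m w))%:R.

Definition expect_of (P : probability T R) (X : T -> R) : \bar R :=
  (\int[P]_w (X w)%:E)%E.

Definition var_of (P : probability T R) (X : T -> R) : \bar R :=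
  (\int[P]_w ((X w - fine (expect_of P X)) ^+ 2)%:E)%E.

Definition indep_from2 (P : probability T R) (X : nat -> T -> bool) : Prop :=
  forall (J : seq nat) (B : nat -> set bool),
    uniq J -> all (fun m => 2 <= m)%N J ->
    P (\big[setI/setT]_(m <- J) (X m @^-1` B m)) =
    (\prod_(m <- J) P (X m @^-1` B m))%E.

Definition Phi (a : R) : R :=
  fine (\int[lebesgue_measure]_(t in `]-oo, a]%classic)
          ((Num.sqrt (2 * pi))^-1 * expR (- (t ^+ 2) / 2))%:E)%E.

Definition kolm_dist (P : probability T R) (X : T -> R) : R :=
  sup [set `| fine (P [set w | (X w - fine (expect_of P X))
                              / Num.sqrt (fine (var_of P X)) <= a])
             - Phi a | | a in [set: R]].

End Prob.

Section Consts.
Context (R : realType).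
Definition sig2 (p1 : R) : R :=
  240 ^+ 2 * p1 + 360 ^+ 2 * (1 - p1) - (240 * p1 + 360 * (1 - p1)) ^+ 2.
Definition sig2t (p1 : R) : R :=
  113 ^+ 2 * p1 + 233 ^+ 2 * (1 - p1) - (113 * p1 + 233 * (1 - p1)) ^+ 2.
Definition r2 (p1 : R) : R :=
  240 * 113 * p1 + 360 * 233 * (1 - p1)
  - (240 * p1 + 360 * (1 - p1)) * (113 * p1 + 233 * (1 - p1)).
Definition var_formula (p1 : R) (n : nat) : R :=
  let s := sig2 p1 in let st := sig2t p1 in let r := r2 p1 in
  let x := n%:R in
  30^-1 * (s * x ^+ 5 - 5 * r * x ^+ 4 + 10 * st * x ^+ 3
           + (65 * r - 30 * s - 45 * st) * x ^+ 2
           + (59 * s + 65 * st - 120 * r) * x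
           + (60 * r - 30 * s - 30 * st)).
End Consts.

(* Main.v *)
Require Import Defs.
From HB Require Import structures.
From mathcomp Require Import all_boot all_order all_algebra.
From mathcomp Require Import all_classical all_reals all_analysis.
From mathcomp Require Import measurable_realfun zify ring lra.
Set Implicit Arguments. Unset Strict Implicit. Unset Printing Implicit Defensive.
Import Order.TTheory GRing.Theory Num.Theory.
Import numFieldNormedType.Exports.
Local Open Scope ring_scope.
Local Open Scope classical_set_scope.

(** Summing degrees and distances over the pentagons, the Schultz index is affine
    in the distances from [x_1] to [u_m] inside each [O_m], and
    [S(PG_n) = c_n + 120 sum_(2 <= m < n) (m - 1) (n - m) Z_m^2] with [c_n]
    deterministic: a weighted sum of independent Bernoulli variables.  The
    variance is then a power sum.

    The central limit theorem is Lindeberg's telescoping along the heat flow.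
    The function [heat t x = Phi (x / sqrt t)] solves
    [d/dt heat = 1/2 d^2/dx^2 heat], so that replacing one centred Bernoulli
    term of weight [w] by the time increment [p q w ^ 2] costs
    [O(w ^ 3 / t ^ (3/2))].  Starting from a time that is a small fraction of
    the variance, [heat] smooths the indicator of a half line, and the total
    cost [sum w ^ 3 / s ^ 3] is of order [n ^ (-1/2)]. *)

(** * The Gaussian distribution function and its heat flow *)

Section Gauss.
Context {R : realType}.
Implicit Types (a x y t : R).

Definition gdens x : R := (Num.sqrt (2 * pi))^-1 * expR (- (x ^+ 2) / 2).

Lemma gdensE : gdens = normal_pdf 0 1.
Proof.
rewrite normal_pdfE ?oner_neq0//; apply/funext => x.
rewrite /gdens /normal_peak /normal_fun subr0 expr1n mul1r.
by rewrite (mulr_natl pi 2).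
Qed.

Lemma PhiE a : Phi a = fine (normal_prob 0 1 `]-oo, a]).
Proof. by rewrite /Phi /normal_prob -gdensE. Qed.

Lemma Phi_is_derive x : is_derive x (1:R) (@Phi R) (gdens x).
Proof.
have [] := @continuous_FTC1 R gdens (BInfty R true) x (x + 1).
- by rewrite ltrDl.
- rewrite gdensE.
  have h := @integrable_normal_pdf R 0 1.
  exact: integrableS h.
- by rewrite ltNyr.
- rewrite gdensE; exact: continuous_normal_pdf (oner_neq0 _) x.
rewrite derive1E => h1 h2.
by apply: DeriveDef.
Qed.

(** The identity, as a random variable under the standard normal law, has [Phi] as its distribution
    function; the limits of [Phi] at both infinities are then those of a cdf. *)
Let idR : measurableTypeR R -> R := idfun.

#[local] HB.instance Definition _ :=
  @isMeasurableFun.Build _ _ _ _ idR (@measurable_id _ _ setT).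

Let Phi_cdf a : Phi a = fine (cdf (idR : {RV (normal_prob 0 1) >-> R}) a).
Proof. by rewrite PhiE /cdf /distribution /pushforward preimage_id. Qed.

Lemma Phi_cvgy : @Phi R x @[x --> +oo] --> (1 : R).
Proof.
rewrite (funext Phi_cdf); apply: fine_cvg; exact: cvg_cdfy1.
Qed.

Lemma Phi_cvgNy : @Phi R x @[x --> -oo] --> (0 : R).
Proof.
rewrite (funext Phi_cdf); apply: fine_cvg; exact: cvg_cdfNy0.
Qed.

Lemma Phi_ge0 a : 0 <= Phi a.
Proof. by rewrite PhiE fine_ge0. Qed.

Lemma Phi_le1 a : Phi a <= 1.
Proof.
by rewrite PhiE -lee_fin fineK ?fin_num_measure// probability_le1.
Qed.

Lemma Phi_nondecreasing x y : x <= y -> Phi x <= Phi y.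
Proof.
move=> xy; rewrite !PhiE fine_le ?fin_num_measure// le_measure ?inE//.
exact: subitvPr.
Qed.

Lemma Phi_tails (e : R) : 0 < e ->
  exists2 L : R, 0 < L & 1 - Phi L <= e /\ Phi (- L) <= e.
Proof.
move=> e0.
have /cvgrPdist_le/(_ _ e0)[A [_ HA]] := Phi_cvgy.
have /cvgrPdist_le/(_ _ e0)[B [_ HB]] := Phi_cvgNy.
exists (`|A| + `|B| + 1); first by rewrite ltr_wpDl// addr_ge0.
  have hA : A < `|A| + `|B| + 1.
  by move: (ler_norm A) (normr_ge0 B); lra.
have hB : - (`|A| + `|B| + 1) < B.
  by move: (ler_norm (- B)) (normr_ge0 A); rewrite normrN; lra.
move: (HA _ hA) (HB _ hB) => /=; rewrite !ler_norml; lra.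
Qed.

Lemma expR_half_sqr y : (1 + y ^+ 2 / 2) * expR (- (y ^+ 2) / 2) <= 1.
Proof.
rewrite mulNr expRN ler_pdivrMr ?expR_gt0// mul1r.
exact: expR_ge1Dx.
Qed.

Lemma gdens_ge0 y : 0 <= gdens y.
Proof. by rewrite mulr_ge0 ?expR_ge0// invr_ge0. Qed.

(** One inequality, from [1 + z <= expR z] at [z = y ^ 2 / 2], controls both [gdens y] and
    [y ^ 2 * gdens y]; the bounds on the derivatives of [heat] rest on these two. *)
Lemma gdens_bound y : (1 + y ^+ 2 / 2) * gdens y <= 1.
Proof.
rewrite mulrCA.
have := expR_half_sqr y; set E := _ * expR _ => hE.
have E0 : 0 <= E by rewrite mulr_ge0 ?expR_ge0// addr_ge0// divr_ge0// sqr_ge0.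
suff : (Num.sqrt (2 * @pi R))^-1 <= 1.
  by move=> h; apply: mulr_ile1; rewrite // invr_ge0.
rewrite invf_le1 ?sqrtr_gt0 ?mulr_gt0 ?pi_gt0//.
rewrite -[leLHS]sqrtr1 ler_wsqrtr//.
have := @pi_ge2 R; lra.
Qed.

Lemma gdens_le1 y : gdens y <= 1.
Proof.
apply: le_trans (gdens_bound y); rewrite ler_peMl ?gdens_ge0// lerDl.
by rewrite divr_ge0 ?sqr_ge0.
Qed.

Lemma gdens_sqr_le2 y : y ^+ 2 * gdens y <= 2.
Proof. have := gdens_bound y; have := gdens_ge0 y; lra. Qed.

Lemma gdens_is_derive y : is_derive y (1:R) gdens (- (y * gdens y)).
Proof.
have -> : gdens = cst (Num.sqrt (2 * pi))^-1 * (expR \o (cst (- 2^-1) * @idfun R ^+ 2)).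
  by apply/funext => x; rewrite /gdens /= !fctE/=; congr (_ * expR _); ring.
apply: is_derive_eq.
rewrite /GRing.scale/= !fctE/= expr1 !mulr0 !mulr1 !addr0 expr2.
set E := expR _; set c := _^-1. 
by field.
Qed.

Definition heat t x := Phi (x / Num.sqrt t).
Definition heat_x t x := gdens (x / Num.sqrt t) / Num.sqrt t.
Definition heat_xx t x :=
  - (x / Num.sqrt t * gdens (x / Num.sqrt t)) / Num.sqrt t ^+ 2.
Definition heat_xxx t x :=
  ((x / Num.sqrt t) ^+ 2 - 1) * gdens (x / Num.sqrt t) / Num.sqrt t ^+ 3.

(** Chain rule along a curve in time and space. That the coefficient of [T'] is [heat_xx / 2] is the
    heat equation. *)
Lemma heat_is_derive (T X : R -> R) (th T' X' : R) : 0 < T th ->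
  is_derive th (1:R) T T' -> is_derive th (1:R) X X' ->
  is_derive th (1:R) (fun th => heat (T th) (X th))
    (heat_x (T th) (X th) * X' + heat_xx (T th) (X th) / 2 * T').
Proof.
move=> T0 dT dX.
have s0 : Num.sqrt (T th) != 0 by rewrite gt_eqF ?sqrtr_gt0.
have dS := is_derive1_sqrt T0.
have dST := is_derive1_comp dS dT.
have dV := @is_deriveV _ (Num.sqrt \o T) _ _ _ s0 dST.
have dM := is_deriveM dX dV.
have dP := is_derive1_comp (Phi_is_derive _) dM.
apply: is_derive_eq dP _.
rewrite /GRing.scale/= !fctE/= /heat_x /heat_xx.
set g := gdens _; set s := Num.sqrt _ in s0 *.
by field.
Qed.

Lemma heat_x_is_derive t x : 0 < t ->
  is_derive x (1:R) (heat_x t) (heat_xx t x).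
Proof.
move=> t0.
have s0 : Num.sqrt t != 0 by rewrite gt_eqF ?sqrtr_gt0.
have dM := is_deriveM (is_derive_id x (1:R)) (is_derive_cst (Num.sqrt t)^-1 x (1:R)).
have dP := is_derive1_comp (gdens_is_derive _) dM.
have dQ := is_deriveM dP (is_derive_cst (Num.sqrt t)^-1 x (1:R)).
apply: is_derive_eq dQ _.
rewrite /GRing.scale/= !fctE/= /heat_xx.
set g := gdens _; set s := Num.sqrt _ in s0 *.
by field.
Qed.

Lemma heat_xx_is_derive t x : 0 < t ->
  is_derive x (1:R) (heat_xx t) (heat_xxx t x).
Proof.
move=> t0.
have s0 : Num.sqrt t != 0 by rewrite gt_eqF ?sqrtr_gt0.
have dM := is_deriveM (is_derive_id x (1:R)) (is_derive_cst (Num.sqrt t)^-1 x (1:R)).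
have dP := is_derive1_comp (gdens_is_derive _) dM.
have dQ := is_deriveN (is_deriveM dM dP).
have dS := is_deriveM dQ (is_derive_cst ((Num.sqrt t)^+2)^-1 x (1:R)).
apply: is_derive_eq dS _.
rewrite /GRing.scale/= !fctE/= /heat_xxx.
set g := gdens _; set s := Num.sqrt _ in s0 *.
by field.
Qed.

Lemma heat_xx_bound t x : 0 < t -> `|heat_xx t x| <= 2 / t.
Proof.
move=> t0.
have ti : 0 <= t^-1 by rewrite invr_ge0 ltW.
rewrite /heat_xx; set y := x / _; rewrite sqr_sqrtr; last exact: ltW.
rewrite normrM (ger0_norm ti) ler_wpM2r// normrN normrM (ger0_norm (gdens_ge0 y)).
have := gdens_sqr_le2 y; have := gdens_le1 y; have := gdens_ge0 y.
(* The inequality [2 |y| <= y ^ 2 + 1] reduces [|y| * gdens y] to the two known bounds. *)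
have : 0 <= (`|y| - 1) ^+ 2 * gdens y by rewrite mulr_ge0 ?gdens_ge0 ?sqr_ge0.
rewrite sqrrB1 real_normK ?num_real// mulrDl mulrBl; lra.
Qed.

Lemma heat_xxx_bound t x : 0 < t -> `|heat_xxx t x| <= 3 / Num.sqrt t ^+ 3.
Proof.
move=> t0.
rewrite /heat_xxx; set y := x / _; set s := Num.sqrt t.
have si : 0 <= (s ^+ 3)^-1 by rewrite invr_ge0 exprn_ge0// sqrtr_ge0.
rewrite normrM (ger0_norm si) ler_wpM2r//.
have := gdens_sqr_le2 y; have := gdens_le1 y; have := gdens_ge0 y.
have : 0 <= y ^+ 2 * gdens y by rewrite mulr_ge0 ?gdens_ge0 ?sqr_ge0.
by rewrite ler_norml mulrBl; lra.
Qed.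

Lemma MVT_bound (f df : R -> R) a b K : a <= b ->
  (forall x, a <= x <= b -> is_derive x (1:R) f (df x)) ->
  (forall x, a <= x <= b -> `|df x| <= K) ->
  `|f b - f a| <= K * (b - a).
Proof.
move=> ab fd dK.
have [x||c] := @MVT_segment R f df a b ab.
- by rewrite in_itv/= => /andP[h1 h2]; apply: fd; rewrite !ltW.
- apply: derivable_within_continuous => x; rewrite in_itv/= => xab.
  by have [] := fd _ xab.
rewrite in_itv/= => /dK cK ->.
by rewrite normrM (ger0_norm (_ : 0 <= b - a)) ?subr_ge0// ler_wpM2r ?subr_ge0.
Qed.

Lemma heat_xxx_le t0 t x : 0 < t0 -> t0 <= t ->
  `|heat_xxx t x| <= 3 / Num.sqrt t0 ^+ 3.
Proof.
move=> h0 h; apply: (le_trans (heat_xxx_bound _ _)); first exact: lt_le_trans h.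
rewrite ler_wpM2l// lef_pV2 ?posrE ?exprn_gt0 ?sqrtr_gt0//.
  by rewrite lerXn2r ?nnegrE ?sqrtr_ge0// ler_wsqrtr.
exact: lt_le_trans h.
Qed.

Lemma heat_xx_lip t0 t x y : 0 < t0 -> t0 <= t -> x <= y ->
  `|heat_xx t y - heat_xx t x| <= 3 / Num.sqrt t0 ^+ 3 * (y - x).
Proof.
move=> h0 h xy; apply: (@MVT_bound _ (heat_xxx t)) => // z _.
  by apply: heat_xx_is_derive; exact: lt_le_trans h.
exact: heat_xxx_le.
Qed.

(* [D] interpolates between the two sides; by the heat equation, [D' th] is the
   error of a quadrature of [heat_xx] over an interval of length [th], hence
   [O(th ^ 2)]. *)
Lemma heat_step (p q t y w : R) : 0 <= p -> 0 <= q -> p + q = 1 -> 0 < t -> 0 <= w ->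
  `|p * heat t (y + q * w) + q * heat t (y - p * w)
    - heat (t + p * q * w ^+ 2) y| <= 3 / Num.sqrt t ^+ 3 * w ^+ 3.
Proof.
move=> p0 q0 pq t0 w0.
set M := 3 / _.
have M0 : 0 <= M by rewrite divr_ge0// exprn_ge0// sqrtr_ge0.
have p1 : p <= 1 by lra.
have q1 : q <= 1 by lra.
(* [T w = t] and [T 0 = t + p q w ^ 2]; at [th = 0] both space points merge at [y]. Since
   [T th >= t] on [[0, w]], the constant [M] serves throughout. *)
pose T th := t + p * q * w ^+ 2 - p * q * th ^+ 2.
pose D th := p * heat (T th) (y + q * th) + q * heat (T th) (y - p * th).
pose D' th := p * q * (heat_x (T th) (y + q * th) - heat_x (T th) (y - p * th)
  - th * (p * heat_xx (T th) (y + q * th) + q * heat_xx (T th) (y - p * th))).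
have pqge0 : 0 <= p * q by rewrite mulr_ge0.
have pqle1 : p * q <= 1 by rewrite mulr_ile1.
have TE th : 0 <= th <= w -> t <= T th.
  move=> /andP[h0 h1]; rewrite /T -addrA -mulrBr lerDl mulr_ge0// subr_ge0.
  by rewrite lerXn2r ?nnegrE.
have TG th : 0 <= th <= w -> 0 < T th by move/TE; exact: lt_le_trans.
have -> : p * heat t (y + q * w) + q * heat t (y - p * w) -
  heat (t + p * q * w ^+ 2) y = D w - D 0.
  by rewrite /D !mulr0 subr0 addr0 -mulrDl pq mul1r /T addrK expr0n/= mulr0 subr0.
have -> : M * w ^+ 3 = M * w ^+ 2 * (w - 0) by ring.
apply: (@MVT_bound _ D') => // th thw.
  have dT : is_derive th (1:R) T (- (p * q * (2 * th))).
    have -> : T = cst (t + p * q * w ^+ 2) - cst (p * q) * @idfun R ^+ 2.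
      by apply/funext => z; rewrite !fctE.
    have d := is_deriveB (is_derive_cst (t + p * q * w ^+ 2) th (1:R))
      (is_deriveM (is_derive_cst (p * q) th (1:R))
                  (is_deriveX 2 (is_derive_id th (1:R)))).
    apply: is_derive_eq d _.
    by rewrite /GRing.scale/= expr1 !mulr0 mulr1 addr0 sub0r.
  have dX c : is_derive th (1:R) (fun th => y + c * th) c.
    have -> : (fun th => y + c * th) = cst y + cst c * @idfun R.
      by apply/funext => z; rewrite !fctE.
    have d := is_deriveD (is_derive_cst y th (1:R))
      (is_deriveM (is_derive_cst c th (1:R)) (is_derive_id th (1:R))).
    apply: is_derive_eq d _.
    by rewrite /GRing.scale/= mulr0 addr0 mulr1 add0r.
  have d1 := heat_is_derive (TG _ thw) dT (dX q).
  have d2 := heat_is_derive (TG _ thw) dT (dX (- p)).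
  have d := is_deriveD (is_deriveM (is_derive_cst p th (1:R)) d1)
                       (is_deriveM (is_derive_cst q th (1:R)) d2).
  have -> : D = cst p * (fun th => heat (T th) (y + q * th)) +
                cst q * (fun th => heat (T th) (y + - p * th)).
    by apply/funext => z; rewrite !fctE /D mulNr.
  apply: is_derive_eq d _.
  rewrite /GRing.scale/= !mulr0 !addr0 /D' mulNr.
  set a1 := heat_x _ _; set a2 := heat_x _ _; set b1 := heat_xx _ _; set b2 := heat_xx _ _.
  by field.
have [h0 h1] := andP thw.
have ab : y - p * th <= y + q * th.
  by rewrite lerD2l (@le_trans _ _ 0) ?oppr_le0 ?mulr_ge0.
have abE : y + q * th - (y - p * th) = th.
  by rewrite -[RHS]mul1r -pq; ring.
set a := y - p * th in ab abE *; set b := y + q * th in ab abE *.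
(* The increment of [heat_x] over [[a, b]], of length [th], is [th * heat_xx] at some [c] between.
   As [p + q = 1], [D'] becomes [p q th] times a weighted difference of increments of [heat_xx] from
   [c], at most [M * w] by the Lipschitz bound. *)
have [x _||c] := @MVT_segment R (heat_x (T th)) (heat_xx (T th)) a b ab.
- by apply: heat_x_is_derive; exact: TG.
- apply: derivable_within_continuous => x _.
  by have [] := heat_x_is_derive x (TG _ thw).
rewrite in_itv/= abE => /andP[ac cb] E.
rewrite /D' -/a -/b E.
have -> : heat_xx (T th) c * th - th * (p * heat_xx (T th) b + q * heat_xx (T th) a)
  = th * (q * (heat_xx (T th) c - heat_xx (T th) a)
     - p * (heat_xx (T th) b - heat_xx (T th) c)).
  by rewrite -[heat_xx (T th) c * th]mul1r -pq; ring.
have L1 := heat_xx_lip t0 (TE _ thw) ac.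
have L2 := heat_xx_lip t0 (TE _ thw) cb.
rewrite -/M in L1 L2.
rewrite normrM (ger0_norm pqge0) normrM (ger0_norm h0).
have : `|q * (heat_xx (T th) c - heat_xx (T th) a)
     - p * (heat_xx (T th) b - heat_xx (T th) c)| <= M * w.
  apply: (le_trans (ler_normB _ _)).
  rewrite !normrM (ger0_norm p0) (ger0_norm q0).
  have -> : M * w = q * (M * w) + p * (M * w) by rewrite -mulrDl addrC pq mul1r.
  apply: lerD; apply: ler_wpM2l => //.
    by apply: (le_trans L1); apply: ler_wpM2l => //; lra.
  by apply: (le_trans L2); apply: ler_wpM2l => //; lra.
set N := `|_| => NM.
have N0 : 0 <= N by exact: normr_ge0.
have -> : M * w ^+ 2 = 1 * (w * (M * w)) by ring.
apply: ler_pM => //; first by rewrite mulr_ge0.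
by apply: ler_pM.
Qed.

(** The heat equation halves the bound [2 / t] on [heat_xx]. This estimate pays for the extra time
    at which the smoothing starts. *)
Lemma heat_time_lip t0 t1 x : 0 < t0 -> t0 <= t1 ->
  `|heat t1 x - heat t0 x| <= t0^-1 * (t1 - t0).
Proof.
move=> h0 h.
apply: (@MVT_bound (heat ^~ x) (fun t => heat_xx t x / 2)) => // t /andP[h1 h2].
  have tp : 0 < t by exact: lt_le_trans h1.
  have d := heat_is_derive (T := @idfun R) (X := cst x) tp (is_derive_id t (1:R))
    (is_derive_cst x t (1:R)).
  by apply: is_derive_eq d _; rewrite /= mulr0 add0r mulr1.
have tp : 0 < t by exact: lt_le_trans h1.
rewrite normrM (ger0_norm (_ : 0 <= 2^-1)) ?invr_ge0//.
rewrite ler_pdivrMr//; apply: (le_trans (heat_xx_bound _ tp)).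
by rewrite mulrC ler_wpM2r// lef_pV2.
Qed.

End Gauss.

(** * Weighted sums of Bernoulli variables *)

Section BernoulliSum.
Context {R : realType}.
Variables p q : R.
Hypotheses (p0 : 0 <= p) (q0 : 0 <= q) (pq1 : p + q = 1).
Implicit Types (ws : seq R) (g : R -> R) (x : R).

(** Expectation of [g] at [x] plus a random subsum of the weights, each taken independently with
    probability [q]. The recursive form makes the limit theorem a statement about finite sums. *)
Fixpoint bern_mean ws g x : R :=
  if ws is w :: ws' then p * bern_mean ws' g x + q * bern_mean ws' g (x + w)
  else g x.

Lemma bern_mean_le ws g h x : (forall y, g y <= h y) ->
  bern_mean ws g x <= bern_mean ws h x.
Proof.
move=> gh; elim: ws x => [|w ws IH] x //=.
by rewrite lerD// ler_wpM2l.
Qed.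

Lemma bern_mean_ge0 ws g x : (forall y, 0 <= g y) -> 0 <= bern_mean ws g x.
Proof.
move=> g0; elim: ws x => [|w ws IH] x //=.
by rewrite addr_ge0// mulr_ge0.
Qed.

Lemma bern_meanDc ws g c x :
  bern_mean ws (fun y => g y + c) x = bern_mean ws g x + c.
Proof.
elim: ws x => [|w ws IH] x //=; rewrite !IH.
rewrite -[in RHS](mul1r c) -pq1; ring.
Qed.

Lemma bern_mean_id ws x :
  bern_mean ws id x = x + q * \sum_(w <- ws) w.
Proof.
elim: ws x => [|w ws IH] x /=; first by rewrite big_nil mulr0 addr0.
rewrite !IH big_cons; set s := \sum_(_ <- _) _.
have -> : p = 1 - q by rewrite -pq1 addrK.
ring.
Qed.

(** The integration formula [integral_failure_sum] is for nonnegative integrands; here the norm is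
    allowed to stand in for the identity when the mean is computed. *)
Lemma bern_mean_norm ws x : 0 <= x -> all (fun w => 0 <= w) ws ->
  bern_mean ws Num.norm x = bern_mean ws id x.
Proof.
elim: ws x => [|w ws IH] x /= x0; first by rewrite ger0_norm.
by move=> /andP[w0 ws0]; rewrite !IH// addr_ge0.
Qed.

(** Squared bias plus variance; the first term vanishes when [m] is the mean. *)
Lemma bern_mean_sqr ws x m :
  bern_mean ws (fun y => (y - m) ^+ 2) x =
  (x + q * (\sum_(w <- ws) w) - m) ^+ 2 + p * q * \sum_(w <- ws) w ^+ 2.
Proof.
elim: ws x => [|w ws IH] x /=; first by rewrite !big_nil !mulr0 !addr0.
rewrite !IH !big_cons; set s := \sum_(_ <- _) _; set s2 := \sum_(_ <- _) _.
have -> : p = 1 - q by rewrite -pq1 addrK.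
ring.
Qed.

(** Lindeberg's telescoping as an induction: the later weights are already traded for time, so the
    step for [w] is made at a time [t' >= t], where the error constant is no larger than at [t]. *)
Lemma bern_mean_heat ws t b x : 0 < t -> all (fun w => 0 <= w) ws ->
  `|bern_mean ws (fun y => heat t (b - y)) x
    - heat (t + p * q * \sum_(w <- ws) w ^+ 2)
        (b - (x + q * \sum_(w <- ws) w))|
  <= 3 / Num.sqrt t ^+ 3 * \sum_(w <- ws) w ^+ 3.
Proof.
move=> t0; elim: ws x => [|w ws IH] x /=.
  by rewrite !big_nil !mulr0 !addr0 subrr normr0.
move=> /andP[w0 ws0]; rewrite !big_cons.
set s := \sum_(v <- ws) v; set s2 := \sum_(v <- ws) v ^+ 2; set s3 := \sum_(v <- ws) v ^+ 3.
have s20 : 0 <= s2 by apply: sumr_ge0 => i _; exact: sqr_ge0.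
set M := 3 / _.
have M0 : 0 <= M by rewrite divr_ge0// exprn_ge0// sqrtr_ge0.
pose t' := t + p * q * s2.
have tt' : t <= t' by rewrite lerDl !mulr_ge0.
have := heat_step (b - (x + q * (w + s))) p0 q0 pq1 (lt_le_trans t0 tt') w0.
move: (IH x ws0) (IH (x + w) ws0); rewrite -/s -/s2 -/s3 -/M -/t'.
have -> : b - (x + q * (w + s)) + q * w = b - (x + q * s) by ring.
have -> : b - (x + q * (w + s)) - p * w = b - (x + w + q * s).
  by have -> : p = 1 - q by [rewrite -pq1 addrK]; ring.
have -> : t + p * q * (w ^+ 2 + s2) = t' + p * q * w ^+ 2 by rewrite /t'; ring.
set A := bern_mean _ _ _; set B := bern_mean _ _ _.
set h1 := heat _ _; set h2 := heat _ _; set h3 := heat _ _.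
move=> H1 H2 H3.
have {}H3 : `|p * h1 + q * h2 - h3| <= M * w ^+ 3.
  apply: (le_trans H3); rewrite ler_wpM2r ?exprn_ge0// ler_wpM2l//.
  rewrite lef_pV2 ?posrE ?exprn_gt0 ?sqrtr_gt0//; last exact: lt_le_trans tt'.
  by rewrite lerXn2r ?nnegrE ?sqrtr_ge0// ler_wsqrtr.
have -> : p * A + q * B - h3 =
  p * (A - h1) + q * (B - h2) + (p * h1 + q * h2 - h3) by ring.
have -> : M * (w ^+ 3 + s3) = p * (M * s3) + q * (M * s3) + M * w ^+ 3.
  by rewrite -mulrDl pq1 mul1r mulrDr addrC.
apply: (le_trans (ler_normD _ _)); apply: lerD => //.
apply: (le_trans (ler_normD _ _)).
by rewrite !normrM (ger0_norm p0) (ger0_norm q0) lerD// ler_wpM2l.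
Qed.

Lemma Phi_lip (x y : R) : x <= y -> `|Phi y - Phi x| <= y - x.
Proof.
move=> xy; rewrite -[leRHS]mul1r.
apply: (@MVT_bound _ _ gdens) => // z _; first exact: Phi_is_derive.
by rewrite ger0_norm ?gdens_ge0// gdens_le1.
Qed.

Lemma heat_scale (s t x : R) : 0 < s -> heat (s ^+ 2 * t) (s * x) = heat t x.
Proof.
move=> s0; rewrite /heat sqrtrM ?sqr_ge0// sqrtr_sqr gtr0_norm//.
by rewrite -mulf_div divff ?mul1r// gt_eqF.
Qed.

(** In units of [s], time starts at [r ^ 2] and ends at [1 + r ^ 2]. The first error term is the
    cost of the replacements; the second brings the time back to [1], where [heat] is [Phi]. *)
Lemma bern_mean_smooth ws x (r a : R) :
  let m := x + q * \sum_(w <- ws) w in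
  let s := Num.sqrt (p * q * \sum_(w <- ws) w ^+ 2) in
  0 < s -> all (fun w => 0 <= w) ws -> 0 < r ->
  `|bern_mean ws (fun y => heat (s ^+ 2 * r ^+ 2) (m + s * a - y)) x - Phi a|
  <= 3 / r ^+ 3 * ((\sum_(w <- ws) w ^+ 3) / s ^+ 3) + r ^+ 2.
Proof.
move=> m s s0 ws0 r0.
have sE : s ^+ 2 = p * q * \sum_(w <- ws) w ^+ 2.
  by rewrite sqr_sqrtr// ltW// -sqrtr_gt0.
have t0 : 0 < s ^+ 2 * r ^+ 2 by rewrite mulr_gt0// exprn_gt0.
have := bern_mean_heat (m + s * a) x t0 ws0.
rewrite -/m -sE.
have -> : m + s * a - m = s * a by ring.
have -> : s ^+ 2 * r ^+ 2 + s ^+ 2 = s ^+ 2 * (1 + r ^+ 2) by ring.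
rewrite heat_scale// sqrtrM ?sqr_ge0// !sqrtr_sqr (gtr0_norm s0) (gtr0_norm r0).
have := @heat_time_lip R 1 (1 + r ^+ 2) a ltr01.
have -> : heat 1 a = Phi a by rewrite /heat sqrtr1 divr1.
rewrite lerDl sqr_ge0 invr1 mul1r => /(_ isT).
have -> : 1 + r ^+ 2 - 1 = r ^+ 2 by ring.
set E := bern_mean _ _ _; set h := heat _ _; set S := \sum_(_ <- _) _ => H1 H2.
have -> : E - Phi a = (E - h) + (h - Phi a) by ring.
apply: (le_trans (ler_normD _ _)); apply: lerD => //.
apply: (le_trans H2); rewrite le_eqVlt; apply/orP; left; apply/eqP.
by field; rewrite !gt_eqF.
Qed.

(* The Gaussian smoothing [heat _ (b - y)] of the indicator of [y <= b] is
   compared with the indicators shifted by [L r] standard deviations, at a cost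
   of the tails of [Phi] beyond [L]. *)
Lemma bern_mean_cdf ws x (L r e a : R) :
  let m := x + q * \sum_(w <- ws) w in
  let s := Num.sqrt (p * q * \sum_(w <- ws) w ^+ 2) in
  0 < s -> all (fun w => 0 <= w) ws -> 0 < r -> 0 < L ->
  1 - Phi L <= e -> Phi (- L) <= e ->
  `|bern_mean ws (fun y => ((y - m) / s <= a)%R%:R) x - Phi a|
  <= e + L * r + 3 / r ^+ 3 * ((\sum_(w <- ws) w ^+ 3) / s ^+ 3) + r ^+ 2.
Proof.
move=> m s s0 ws0 r0 L0 e1 e2.
have sn0 : s != 0 by rewrite gt_eqF.
have rn0 : r != 0 by rewrite gt_eqF.
have heatE b y : heat (s ^+ 2 * r ^+ 2) (m + s * b - y) = Phi ((b - (y - m) / s) / r).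
  rewrite /heat sqrtrM ?sqr_ge0// !sqrtr_sqr (gtr0_norm s0) (gtr0_norm r0); congr Phi.
  by field; rewrite sn0 rn0.
have Lr0 : 0 <= L * r by rewrite mulr_ge0 ?ltW.
(* Where the indicator is [1], the argument of [Phi] is at least [L], so the loss is at most the
   tail [1 - Phi L <= e]. The lower bound [lo] mirrors this with [- L]. *)
have up y : ((y - m) / s <= a)%R%:R <=
    heat (s ^+ 2 * r ^+ 2) (m + s * (a + L * r) - y) + e.
  rewrite heatE; case: (leP ((y - m) / s) a) => h /=; last first.
    by rewrite addr_ge0 ?Phi_ge0// (le_trans _ e2) ?Phi_ge0.
  have : Phi L <= Phi ((a + L * r - (y - m) / s) / r).
    by apply: Phi_nondecreasing; rewrite ler_pdivlMr//; lra.
  lra.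
have lo y : heat (s ^+ 2 * r ^+ 2) (m + s * (a - L * r) - y) + - e <=
    ((y - m) / s <= a)%R%:R.
  rewrite heatE; case: (leP ((y - m) / s) a) => h /=.
    have := Phi_le1 ((a - L * r - (y - m) / s) / r).
    have : 0 <= e by rewrite (le_trans _ e2) ?Phi_ge0.
    by lra.
  have : Phi ((a - L * r - (y - m) / s) / r) <= Phi (- L).
    by apply: Phi_nondecreasing; rewrite ler_pdivrMr//; lra.
  lra.
have := bern_mean_le ws x lo; have := bern_mean_le ws x up.
rewrite !bern_meanDc.
have := bern_mean_smooth x (a + L * r) s0 ws0 r0.
have := bern_mean_smooth x (a - L * r) s0 ws0 r0.
rewrite -/m -/s.
have : `|Phi (a + L * r) - Phi a| <= a + L * r - a by apply: Phi_lip; lra.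
have : `|Phi a - Phi (a - L * r)| <= a - (a - L * r) by apply: Phi_lip; lra.
rewrite !ler_norml; lra.
Qed.

End BernoulliSum.

(** [L], [r] and hence [K] depend on [e] alone, so the weights may change with [n] and the bound is
    uniform in [a]. *)
Lemma bern_mean_clt (R : realType) (e : R) : 0 < e ->
  exists2 K : R, 0 <= K &
  forall (p q : R) (ws : seq R) (x a : R),
  0 <= p -> 0 <= q -> p + q = 1 ->
  let m := x + q * \sum_(w <- ws) w in
  let s := Num.sqrt (p * q * \sum_(w <- ws) w ^+ 2) in
  0 < s -> all (fun w => 0 <= w) ws ->
  `|bern_mean p q ws (fun y => ((y - m) / s <= a)%R%:R) x - Phi a|
  <= e + K * ((\sum_(w <- ws) w ^+ 3) / s ^+ 3).
Proof.
move=> e0.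
have e20 : 0 < e / 2 by rewrite divr_gt0.
have [L L0 [tL tNL]] := Phi_tails e20.
(* The cap at [1] gives [r ^ 2 <= r], so [L * r + r ^ 2 <= (L + 1) * r <= e / 2]; the tails of [Phi]
   take the other half. *)
pose r := Num.min 1 (e / 2 / (L + 1)).
have L10 : 0 < L + 1 by rewrite addr_gt0.
have r0 : 0 < r by rewrite lt_min ltr01 divr_gt0.
have r1 : r <= 1 by rewrite ge_min lexx.
have r2 : (L + 1) * r <= e / 2.
  by rewrite mulrC -ler_pdivlMr// ge_min lexx orbT.
exists (3 / r ^+ 3); first by rewrite divr_ge0// exprn_ge0// ltW.
move=> p q ws x a p0 q0 pq m s s0 ws0.
apply: (le_trans (bern_mean_cdf p0 q0 pq x a s0 ws0 r0 L0 tL tNL)).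
have : r ^+ 2 <= r by rewrite expr2 ler_piMr// ltW.
rewrite -/s; lra.
Qed.

(** * Law of weighted sums of independent indicators *)

Section BernoulliLaw.
Context {R : realType} {d : measure_display} {T : measurableType d}.
Variables (P : probability T R) (X : nat -> T -> bool) (p : R).
Hypothesis mX : forall m, (2 <= m)%N -> measurable [set w | X m w].
Hypothesis PX : forall m, (2 <= m)%N -> P [set w | X m w] = p%:E.
Hypotheses (p0 : 0 <= p) (p1 : p <= 1).
Hypothesis iX : indep_from2 P X.
Implicit Types (J K : seq nat) (wt : nat -> R) (g : R -> R).

(** A weight counts where [X m] fails, with probability [1 - p]: for the chain, failure of [Z1] is
    the larger distance [2]. *)
Definition failure_sum wt J w : R := \sum_(m <- J) wt m * (~~ X m w)%:R.

Let measurable_X m : (2 <= m)%N -> measurable_fun [set: T] (X m).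
Proof.
move=> m2; apply: (measurable_fun_bool true); rewrite setTI.
exact: mX.
Qed.

Let measurable_preX m (B : set bool) : (2 <= m)%N -> measurable (X m @^-1` B).
Proof. by move=> m2; rewrite -[_ @^-1` _]setTI; exact: measurable_X. Qed.

Let P_true m : (2 <= m)%N -> P (X m @^-1` [set true]) = p%:E.
Proof. by move=> m2; rewrite -(PX m2). Qed.

Let P_false m : (2 <= m)%N -> P (X m @^-1` [set false]) = (1 - p)%:E.
Proof.
move=> m2; have -> : X m @^-1` [set false] = ~` [set w | X m w].
  by apply/seteqP; split=> w /=; [move=> ->|move/negP/negbTE].
by rewrite probability_setC ?PX//; exact: mX.
Qed.

Lemma measurable_failure_sum wt J g x : all (fun m => 2 <= m)%N J ->
  measurable_fun [set: T] (fun w => g (x + failure_sum wt J w)).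
Proof.
rewrite /failure_sum; elim: J x => [|m J IH] x.
  by move=> _; under eq_fun do rewrite big_nil; exact: measurable_cst.
move=> /= /andP[m2 J2].
have -> : (fun w => g (x + \sum_(m <- m :: J) wt m * (~~ X m w)%:R)) =
  (fun w => if X m w then g (x + \sum_(m <- J) wt m * (~~ X m w)%:R)
            else g (x + wt m + \sum_(m <- J) wt m * (~~ X m w)%:R)).
  by apply/funext => w; rewrite big_cons; case: (X m w) => /=;
    rewrite ?mulr0 ?add0r// mulr1 addrA.
by apply: measurable_fun_ifT; [exact: measurable_X|exact: IH|exact: IH].
Qed.

Definition cylinder (B : nat -> set bool) K : set T :=
  \big[setI/setT]_(m <- K) (X m @^-1` B m).

Let measurable_cylinder B K : all (fun m => 2 <= m)%N K ->
  measurable (cylinder B K).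
Proof.
rewrite /cylinder; elim: K => [|m K IH] /=; first by rewrite big_nil.
by move=> /andP[m2 K2]; rewrite big_cons; apply: measurableI; [exact: measurable_preX|exact: IH].
Qed.

Let cylinder_upd B K m b : m \notin K ->
  cylinder (fun k => if k == m then [set b] else B k) (m :: K) =
  X m @^-1` [set b] `&` cylinder B K.
Proof.
move=> mK; rewrite /cylinder big_cons eqxx; congr (_ `&` _).
rewrite !big_seq; apply: eq_bigr => k kK.
by case: eqP mK => // <-; rewrite kK.
Qed.

Let P_cylinder_upd B K m b : (2 <= m)%N -> all (fun m => 2 <= m)%N K ->
  uniq (m :: K) ->
  P (X m @^-1` [set b] `&` cylinder B K) =
  (P (X m @^-1` [set b]) * P (cylinder B K))%E.
Proof.
move=> m2 K2 /=/andP[mK uK].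
rewrite -cylinder_upd// [LHS]iX//=; last 2 first.
- by rewrite mK.
- by rewrite m2.
rewrite big_cons eqxx; congr (_ * _)%E.
rewrite [RHS]iX// !big_seq; apply: eq_bigr => k kK.
by case: eqP mK => // <-; rewrite kK.
Qed.

(** Independence is given for events, so the induction integrates over an event on the coordinates
    [K]: each index leaves [J] and joins [K], once for each outcome. *)
Lemma integral_failure_sum_cylinder wt g J B K x : (forall y, 0 <= g y) ->
  uniq (J ++ K) -> all (fun m => 2 <= m)%N (J ++ K) ->
  (\int[P]_(w in cylinder B K) (g (x + failure_sum wt J w))%:E =
   (bern_mean p (1 - p) (map wt J) g x)%:E * P (cylinder B K))%E.
Proof.
move=> g0; elim: J B K x => [|m J IH] B K x.
  move=> /= uK K2; rewrite /failure_sum; under eq_integral do rewrite big_nil addr0.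
  by rewrite integral_cst//; exact: measurable_cylinder.
move=> uJK aJK.
have [m2 [J2 K2]] : (2 <= m)%N /\ all (fun m => 2 <= m)%N J /\ all (fun m => 2 <= m)%N K.
  by move: aJK; rewrite /= all_cat => /and3P[].
have mJ2 : all (fun m => 2 <= m)%N (m :: J) by rewrite /= m2.
have umK : uniq (m :: K).
  by move: uJK; rewrite /= cat_uniq mem_cat negb_or => /andP[/andP[_ ->] /and3P[]].
have mK : m \notin K by case/andP: umK.
have uJmK : uniq (J ++ m :: K).
  by rewrite (perm_uniq (permEl (perm_catCA J [:: m] K))).
have aJmK : all (fun m => 2 <= m)%N (J ++ m :: K).
  by rewrite all_cat /= J2 m2 K2.
(* On the event [X m = b] the term of [m] is constant and is absorbed into the starting point
   [y]. *)
have part b y : (forall w, X m w = b -> x + failure_sum wt (m :: J) w = y + failure_sum wt J w) ->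
  (\int[P]_(w in X m @^-1` [set b] `&` cylinder B K)
      (g (x + failure_sum wt (m :: J) w))%:E =
   (bern_mean p (1 - p) (map wt J) g y)%:E *
     (P (X m @^-1` [set b]) * P (cylinder B K)))%E.
  move=> E; rewrite -P_cylinder_upd// -cylinder_upd// -IH//.
  apply: eq_integral => w; rewrite inE cylinder_upd// => -[/= Xmb _].
  by rewrite E.
have split : cylinder B K = (X m @^-1` [set true] `&` cylinder B K) `|`
                            (X m @^-1` [set false] `&` cylinder B K).
  rewrite -setIUl -preimage_setU.
  rewrite (_ : [set true] `|` [set false] = setT) ?preimage_setT ?setTI//.
  by apply/seteqP; split=> // -[] _; [left|right].
rewrite {1}split ge0_integral_setU//=; last 5 first.
- by apply: measurableI; [exact: measurable_preX|exact: measurable_cylinder].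
- by apply: measurableI; [exact: measurable_preX|exact: measurable_cylinder].
- apply/measurable_EFinP; apply: measurable_funTS.
  exact: measurable_failure_sum.
- by move=> w _; rewrite lee_fin.
- apply/disj_setPS => w [[/= h _] [/= h' _]]; by rewrite h in h'.
rewrite (part true x) ?(part false (x + wt m)); last 2 first.
- by move=> w Xw; rewrite /failure_sum big_cons Xw mulr1 addrA.
- by move=> w Xw; rewrite /failure_sum big_cons Xw mulr0 add0r.
rewrite P_true// P_false//= !muleA -!EFinM -ge0_muleDl.
- by rewrite -EFinD mulrC [in X in (_ + X)%:E]mulrC.
- by rewrite lee_fin mulr_ge0// bern_mean_ge0// subr_ge0.
- by rewrite lee_fin mulr_ge0 ?bern_mean_ge0// subr_ge0.
Qed.

Lemma integral_failure_sum wt g J x : (forall y, 0 <= g y) ->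
  uniq J -> all (fun m => 2 <= m)%N J ->
  (\int[P]_w (g (x + failure_sum wt J w))%:E =
   (bern_mean p (1 - p) (map wt J) g x)%:E)%E.
Proof.
move=> g0 uJ J2.
have := @integral_failure_sum_cylinder wt g J (fun=> setT) [::] x g0.
rewrite cats0 /cylinder big_nil => -> //.
by rewrite [P _]probability_setT mule1.
Qed.

Section Moments.
Variables (wt : nat -> R) (J : seq nat) (x : R).
Hypotheses (x0 : 0 <= x) (wt0 : forall m, 0 <= wt m).
Hypotheses (uJ : uniq J) (J2 : all (fun m => 2 <= m)%N J).

Let S w := x + failure_sum wt J w.

Let q1 : p + (1 - p) = 1. Proof. by rewrite addrC subrK. Qed.

Let wtJ0 : all (fun v => 0 <= v) (map wt J).
Proof. by apply/allP => _ /mapP[m _ ->]. Qed.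

Lemma expect_failure_sum :
  expect_of P S = (x + (1 - p) * \sum_(m <- J) wt m)%:E.
Proof.
rewrite /expect_of -(big_map wt xpredT id) -(bern_mean_id q1) -bern_mean_norm//.
rewrite -integral_failure_sum//.
apply: eq_integral => w _; rewrite ger0_norm// addr_ge0//.
by apply: sumr_ge0 => m _; rewrite mulr_ge0.
Qed.

Lemma var_failure_sum :
  var_of P S = (p * (1 - p) * \sum_(m <- J) wt m ^+ 2)%:E.
Proof.
rewrite /var_of expect_failure_sum.
rewrite [LHS](integral_failure_sum wt (g := fun y =>
  (y - (x + (1 - p) * \sum_(m <- J) wt m)) ^+ 2))//; last first.
  by move=> y; exact: sqr_ge0.
by rewrite bern_mean_sqr// !big_map subrr expr0n/= add0r.
Qed.

Lemma cdf_failure_sum m s a :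
  P [set w | (S w - m) / s <= a] =
  (bern_mean p (1 - p) (map wt J) (fun y => ((y - m) / s <= a)%R%:R) x)%:E.
Proof.
rewrite -integral_failure_sum//.
have mS : measurable [set w | (S w - m) / s <= a].
  have := @measurable_failure_sum wt J (fun y => (y - m) / s) x J2.
  move=> /(_ measurableT `]-oo, a]%classic); rewrite setTI => h.
  apply: eq_ind (h _) _ _; first exact: measurable_itv.
  by apply/seteqP; split=> w /=; rewrite in_itv.
rewrite -[X in P X]setIT -integral_indic//.
apply: eq_integral => w _; rewrite indicE; congr ((nat_of_bool _)%:R%:E).
by apply/idP/idP; rewrite inE.
Qed.

End Moments.

End BernoulliLaw.

(** [sup] bounds its set from above only once the set is known to be nonempty and bounded; its
    members being nonnegative, so is the supremum. *)
Lemma kolm_dist_bound (R : realType) (d : measure_display)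
    (T : measurableType d) (Q : probability T R) (Y : T -> R) (K : R) :
  (forall a, `|fine (Q [set w | (Y w - fine (expect_of Q Y)) /
     Num.sqrt (fine (var_of Q Y)) <= a]) - Phi a| <= K) ->
  0 <= kolm_dist Q Y <= K.
Proof.
move=> h; rewrite /kolm_dist; set A := [set _ | _ in _].
have A0 : A !=set0 by eexists; exists 0.
have hA : has_sup A by split=> //; exists K => _ [a _ <-].
apply/andP; split; last by apply: ge_sup => // _ [a _ <-].
case: (A0) => z Az; apply: le_trans (sup_upper_bound hA Az).
by case: Az => a _ <-; exact: normr_ge0.
Qed.

(** * Distances and degrees in the pentagonal chain *)

Section PentagonChain.
Local Open Scope nat_scope.
Implicit Types (u : nat -> 'I_5) (a b i j k l m n r : nat).

(** The shorter of the two arcs of the 5-cycle; [+ 5] keeps the truncated subtraction exact. *)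
Definition c5 l r := minn ((l + 5 - r) %% 5) ((r + 5 - l) %% 5).

Definition nbr5 l r := (l == r.+1 %% 5) || (r == l.+1 %% 5).

Lemma lt5P l : l < 5 -> [\/ l = 0, l = 1, l = 2 | l = 3 \/ l = 4].
Proof.
case: l => [|[|[|[|[|l]]]]] // _; [exact: Or41|exact: Or42|exact: Or43| |].
  by apply: Or44; left.
by apply: Or44; right.
Qed.

Lemma c5C l r : c5 l r = c5 r l.
Proof. by rewrite /c5 minnC. Qed.

Lemma c5_refl l : l < 5 -> c5 l l = 0.
Proof. by move=> /lt5P[->|->|->|[]->]. Qed.

Lemma c5_le2 l r : l < 5 -> r < 5 -> c5 l r <= 2.
Proof. by move=> /lt5P[->|->|->|[]->] /lt5P[->|->|->|[]->]. Qed.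

Lemma c5_nbr l r r' : l < 5 -> r < 5 -> r' < 5 -> nbr5 r r' ->
  c5 l r' <= c5 l r + 1.
Proof. by move=> /lt5P[->|->|->|[]->] /lt5P[->|->|->|[]->] /lt5P[->|->|->|[]->]. Qed.

Lemma c5_walk r r' : r < 5 -> r' < 5 -> r != r' ->
  exists2 t, t < 5 & nbr5 t r' /\ c5 r r' = (c5 r t).+1.
Proof.
move=> /lt5P[->|->|->|[]->] /lt5P[->|->|->|[]->] //= _;
  (by exists 0) || (by exists 1) || (by exists 2) || (by exists 3) || (by exists 4).
Qed.

Lemma pg_adj_blocks n u i l j r : l < 5 -> r < 5 -> i < n -> j < n ->
  pg_adj n u (5 * i + l) (5 * j + r) =
  [|| (i == j) && nbr5 l r,
      (j == i.+1) && (r == 0) && (l == u i.+1) |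
      (i == j.+1) && (l == 0) && (r == u j.+1)].
Proof.
move=> l5 r5 iN jN; rewrite /pg_adj /pg_link /nbr5.
have -> : 5 * i + l < 5 * n by lia.
have -> : 5 * j + r < 5 * n by lia.
have -> : (5 * i + l) %/ 5 = i by lia.
have -> : (5 * j + r) %/ 5 = j by lia.
have -> : (5 * i + l) %% 5 = l by lia.
have -> : (5 * j + r) %% 5 = r by lia.
rewrite /=; congr (_ || (_ || _)).
- case: j jN => [|j] jN /=; first by rewrite andbF.
  rewrite eqSS; case: (eqVneq j i) => [->|ji] /=.
    by rewrite eqn_add2l.
  rewrite andbC; apply/negbTE; have := ltn_ord (u j.+1); lia.
- case: i iN => [|i] iN /=; first by rewrite andbF.
  rewrite eqSS; case: (eqVneq i j) => [->|ij] /=.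
    by rewrite eqn_add2l.
  rewrite andbC; apply/negbTE; have := ltn_ord (u i.+1); lia.
Qed.

(* For [i < j], the distance from the vertex [5 i + l] to the vertex [x_1] of
   the block [j], i.e. to [5 j]. *)
Definition root_dist u i l j :=
  c5 l (u i.+1) + 1 + \sum_(i.+1 <= k < j) (c5 0 (u k.+1) + 1).

Definition block_dist u i l j r :=
  if i == j then c5 l r
  else if i < j then root_dist u i l j + c5 0 r
  else root_dist u j r i + c5 0 l.

Lemma root_dist_next u i l : root_dist u i l i.+1 = c5 l (u i.+1) + 1.
Proof. by rewrite /root_dist big_geq// addn0. Qed.

Lemma root_distS u i l j : i < j ->
  root_dist u i l j.+1 = root_dist u i l j + c5 0 (u j.+1) + 1.
Proof. by move=> ij; rewrite /root_dist big_nat_recr//= !addnA. Qed.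

Lemma root_dist_first u i j : i.+1 < j ->
  root_dist u i (u i.+1) j = (root_dist u i.+1 0 j).+1.
Proof.
move=> ij; rewrite /root_dist c5_refl// big_ltn//; lia.
Qed.

(** A bridge is a cut edge, so its two ends lie at distances from a given vertex that differ by
    exactly one; the side on which block [i] lies decides which end is nearer. *)
Lemma block_dist_link u i l m : l < 5 ->
  block_dist u i l m.+1 0 = (block_dist u i l m (u m.+1)).+1 \/
  (block_dist u i l m.+1 0).+1 = block_dist u i l m (u m.+1).
Proof.
move=> l5; rewrite /block_dist.
case: (ltngtP i m) => [im|mi|->].
- have im1 : i < m.+1 by exact: ltnW.
  by left; rewrite (ltn_eqF im1) im1 root_distS// (@c5_refl 0)// addn0 addn1.
- case: (ltngtP i m.+1) => [|mi'|->]; first by lia.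
  + by right; rewrite root_dist_first.
  + by right; rewrite root_dist_next c5_refl// c5C.
- by left; rewrite (ltn_eqF (ltnSn m)) ltnSn root_dist_next (@c5_refl 0)// addn0 addn1.
Qed.

(** Edges inside a block and bridges both raise [block_dist] by at most one; this makes it a lower
    bound for the length of every walk. *)
Lemma block_dist_adj n u i l j r j' r' :
  l < 5 -> r < 5 -> r' < 5 -> j < n -> j' < n ->
  pg_adj n u (5 * j + r) (5 * j' + r') ->
  block_dist u i l j' r' <= (block_dist u i l j r).+1.
Proof.
move=> l5 r5 r5' jN jN'; rewrite pg_adj_blocks// => /or3P[].
- move=> /andP[/eqP <- rr']; rewrite /block_dist.
  have [_|_|_] := ltngtP i j.
  + by have := @c5_nbr 0 _ _ isT r5 r5' rr'; lia.
  + rewrite /root_dist; have := c5_nbr (ltn_ord (u j.+1)) r5 r5' rr'.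
    rewrite ![c5 (u _) _]c5C; lia.
  + by have := c5_nbr l5 r5 r5' rr'; lia.
- move=> /andP[/andP[/eqP -> /eqP ->] /eqP ->].
  by have := block_dist_link u i j l5; lia.
- move=> /andP[/andP[/eqP -> /eqP ->] /eqP ->].
  by have := block_dist_link u i j' l5; lia.
Qed.

Lemma pg_reach_le n u i l k j r : l < 5 -> r < 5 -> i < n -> j < n ->
  pg_reach n u k (5 * i + l) (5 * j + r) -> block_dist u i l j r <= k.
Proof.
move=> l5 + iN; elim: k j r => [|k IH] j r r5 jN /=.
  move=> /eqP E; have [-> ->] : i = j /\ l = r by lia.
  by rewrite /block_dist eqxx c5_refl.
move=> /orP[/(IH _ _ r5 jN)|/hasP[c]]; first by lia.
rewrite mem_iota add0n => /andP[_ cN] /andP[].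
have cE : c = 5 * (c %/ 5) + c %% 5 by rewrite mulnC -divn_eq.
rewrite {1 2}cE => h1 h2.
have c5' : c %% 5 < 5 by rewrite ltn_mod.
have cN' : c %/ 5 < n by lia.
have := IH _ _ c5' cN' h1.
have := block_dist_adj i l5 c5' r5 cN' jN h2; lia.
Qed.

Lemma pg_reach_edge n u k a b c : c < 5 * n -> b < 5 * n ->
  pg_reach n u k a c -> pg_adj n u c b -> pg_reach n u k.+1 a b.
Proof.
move=> cN bN ac cb /=; apply/orP; right; apply/hasP; exists c.
  by rewrite mem_iota.
by rewrite ac.
Qed.

Lemma pg_reach_block n u k a j r r' : r < 5 -> r' < 5 -> j < n ->
  pg_reach n u k a (5 * j + r) ->
  pg_reach n u (k + c5 r r') a (5 * j + r').
Proof.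
move=> r5 + jN h; move E : (c5 r r') => t.
elim: t r' E => [|t IH] r' E r5'.
  have [<-|rr'] := eqVneq r r'; first by rewrite addn0.
  by have [s _ [_]] := c5_walk r5 r5' rr'; rewrite E.
have [rr'|rr'] := eqVneq r r'; first by rewrite rr' c5_refl in E.
have [s s5 [sr']] := c5_walk r5 r5' rr'; rewrite E => -[Es].
rewrite addnS; apply: pg_reach_edge (IH s (esym Es) s5) _; try lia.
by rewrite pg_adj_blocks// eqxx sr'.
Qed.

(** The walk crosses each pentagon to its exit vertex and then takes the bridge; this is the upper
    bound on the distance. *)
Lemma pg_reach_root n u i l j : l < 5 -> i < j -> j < n ->
  pg_reach n u (root_dist u i l j) (5 * i + l) (5 * j + 0).
Proof.
move=> l5; elim: j => // j IH; rewrite ltnS leq_eqVlt => /orP[/eqP <-|ij] jN.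
  have h0 : pg_reach n u 0 (5 * i + l) (5 * i + l) by rewrite /=.
  have := pg_reach_block l5 (ltn_ord (u i.+1)) (ltnW jN) h0.
  rewrite root_dist_next addn1 add0n => h; apply: pg_reach_edge h _; try lia.
    by have := ltn_ord (u i.+1); lia.
  by rewrite pg_adj_blocks ?eqxx ?orbT//; lia.
have := pg_reach_block (isT : 0 < 5) (ltn_ord (u j.+1)) (ltnW jN) (IH ij (ltnW jN)).
rewrite root_distS// addn1 => h; apply: pg_reach_edge h _; try lia.
  by have := ltn_ord (u j.+1); lia.
by rewrite pg_adj_blocks ?eqxx ?orbT//; lia.
Qed.

Lemma pg_reach_block_dist n u i l j r : l < 5 -> r < 5 -> i <= j -> j < n ->
  pg_reach n u (block_dist u i l j r) (5 * i + l) (5 * j + r).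
Proof.
move=> l5 r5 ij jN; rewrite /block_dist; case: (ltngtP i j) ij => // [ij|->] _.
  exact: pg_reach_block (pg_reach_root _ l5 ij jN).
have h0 : pg_reach n u 0 (5 * j + l) (5 * j + l) by rewrite /=.
exact: pg_reach_block h0.
Qed.

(** Each block costs at most [2] inside and [1] for the bridge. The bound keeps the distance within
    the range [iota 0 (5 * n)] searched by [pg_dist]. *)
Lemma root_dist_bound u i l j : l < 5 -> i < j ->
  root_dist u i l j <= 3 * (j - i).
Proof.
move=> l5; elim: j => // j IH; rewrite ltnS leq_eqVlt => /orP[/eqP <-|ij].
  by rewrite root_dist_next; have := c5_le2 l5 (ltn_ord (u i.+1)); lia.
rewrite root_distS//.
by have := IH ij; have := @c5_le2 0 (u j.+1) isT (ltn_ord _); lia.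
Qed.

Lemma find_iota_min (P : pred nat) N d : P d -> d < N ->
  (forall k, P k -> d <= k) -> find P (iota 0 N) = d.
Proof.
move=> Pd dN dmin; have hP : has P (iota 0 N).
  by apply/hasP; exists d; rewrite ?mem_iota.
have fN : find P (iota 0 N) < N by rewrite -[X in _ < X](size_iota 0) -has_find.
apply/eqP; rewrite eqn_leq; apply/andP; split.
  rewrite leqNgt; apply/negP => /(before_find 0).
  by rewrite nth_iota// Pd.
apply: dmin; have := nth_find 0 hP.
by rewrite nth_iota.
Qed.

Lemma pg_distE n u i l j r : l < 5 -> r < 5 -> i <= j -> j < n ->
  pg_dist n u (5 * i + l) (5 * j + r) = block_dist u i l j r.
Proof.
move=> l5 r5 ij jN; apply: find_iota_min.
- exact: pg_reach_block_dist.
- rewrite /block_dist; case: (ltngtP i j) ij => // [ij|_] _.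
    have := root_dist_bound u l5 ij; have := @c5_le2 0 r isT r5; lia.
  have := c5_le2 l5 r5; lia.
- by move=> k; apply: pg_reach_le => //; exact: leq_ltn_trans jN.
Qed.

End PentagonChain.

(** * Degrees and the Schultz double sum, block by block *)

Section SchultzIndex.
Local Open Scope nat_scope.
Implicit Types (u : nat -> 'I_5) (a b i j k l m n r : nat).

Lemma sum5E (F : nat -> nat) :
  \sum_(0 <= r < 5) F r = F 0 + F 1 + F 2 + F 3 + F 4.
Proof. by rewrite !big_nat_recr//= big_geq// add0n. Qed.

Lemma sum_blocks (F : nat -> nat) n :
  \sum_(0 <= b < 5 * n) F b = \sum_(0 <= j < n) \sum_(0 <= r < 5) F (5 * j + r).
Proof.
elim: n => [|n IH]; first by rewrite muln0 !big_geq.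
rewrite [RHS]big_nat_recr//= -IH mulnS addnC (@big_cat_nat _ _ _ (5 * n))//= ?leq_addr//.
congr (_ + _); rewrite -{1}[5 * n]add0n big_addn addKn.
by apply: eq_bigr => r _; rewrite addnC.
Qed.

Lemma sum_delta (F : nat -> nat) n i :
  \sum_(0 <= j < n) (i == j) * F j = (i < n) * F i.
Proof.
elim: n => [|n IH]; first by rewrite big_geq.
rewrite big_nat_recr//= IH; have [->|] := eqVneq i n; first by rewrite ltnn ltnSn.
by move=> ni; rewrite addn0 ltnS [in RHS]leq_eqVlt (negbTE ni).
Qed.

Lemma nbr5_sum l : l < 5 -> \sum_(0 <= r < 5) nbr5 l r = 2.
Proof. by rewrite sum5E => /lt5P[->|->|->|[]->]. Qed.

Lemma eq_sum l : l < 5 -> \sum_(0 <= r < 5) (r == l) = 1.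
Proof. by rewrite sum5E => /lt5P[->|->|->|[]->]. Qed.

Lemma pg_degE n u i l : l < 5 -> i < n ->
  pg_deg n u (5 * i + l) =
  2 + (0 < i) * (l == 0) + (i.+1 < n) * (l == u i.+1).
Proof.
move=> l5 iN; rewrite /pg_deg -sum1_count big_mkcond/=.
rewrite -[X in iota 0 X]subn0 -/(index_iota 0 (5 * n)) sum_blocks.
under eq_big_nat => j jN.
  rewrite (_ : \sum_(0 <= r < 5) _ = (i == j) * \sum_(0 <= r < 5) nbr5 l r +
    (i.+1 == j) * (l == u i.+1) + (i == j.+1) * (l == 0)).
  over.
  (* Each indicator is spread over the five offsets as a sum with one nonzero term, so that the
     identity can be checked pair by pair. *)
  have -> : nat_of_bool (l == 0) = \sum_(0 <= r < 5) (r == u j.+1) * (l == 0).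
    by rewrite -big_distrl/= eq_sum// mul1n.
  have -> : nat_of_bool (l == u i.+1) = \sum_(0 <= r < 5) (r == 0) * (l == u i.+1).
    by rewrite -big_distrl/= eq_sum// mul1n.
  rewrite !big_distrr/= -!big_split/=; apply: eq_big_nat => r r5.
  have [jn r5l] : j < n /\ r < 5 by move: jN r5 => /andP[_ ->] /andP[_ ->].
  rewrite pg_adj_blocks//.
  rewrite [j == i.+1]eq_sym.
  have [->|ij] := eqVneq i j.
    rewrite (gtn_eqF (ltnSn j)) (ltn_eqF (ltnSn j)) /= ?orbF. by case: nbr5.
  have [<-|ij'] /= := eqVneq i.+1 j.
    by rewrite (ltn_eqF (leqW (ltnSn i))) /= orbF; case: (r == 0); case: (l == _).
  by rewrite !mul0n; case: (i == _); case: (r == _); case: (l == 0).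
rewrite !big_split/= nbr5_sum// !sum_delta iN mul1n.
rewrite -addnA [X in _ + X]addnC addnA; congr (_ + _ + _).
case: i iN => [|i] iN; first by rewrite big1.
under eq_bigr do rewrite eqSS.
by rewrite sum_delta (ltnW iN).
Qed.

(** Turning the constraint [a < b] into a 0/1 factor lets both indices range over all blocks, after
    which the sums can be exchanged. *)
Lemma schultz_blocks n u :
  schultz n u = \sum_(0 <= i < n) \sum_(0 <= j < n)
    \sum_(0 <= l < 5) \sum_(0 <= r < 5) (5 * i + l < 5 * j + r) *
      ((pg_deg n u (5 * i + l) + pg_deg n u (5 * j + r)) *
        pg_dist n u (5 * i + l) (5 * j + r)).
Proof.
rewrite /schultz.
under eq_big_nat => a aN.
  rewrite (_ : \sum_(_ <= b < _) _ = \sum_(0 <= b < 5 * n) (a < b) *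
     ((pg_deg n u a + pg_deg n u b) * pg_dist n u a b)); first over.
  have aN5 : a < 5 * n by case/andP: aN.
  rewrite [RHS](@big_cat_nat _ _ _ a.+1)//=.
  rewrite [X in _ = X + _]big_nat_cond [X in _ = X + _]big1 ?add0n.
    by apply: eq_big_nat => b /andP[ab _]; rewrite ab mul1n.
  by move=> b /andP[/andP[_ ab] _]; rewrite ltnNge -ltnS ab.
rewrite sum_blocks; apply: eq_bigr => i _.
under eq_bigr do rewrite sum_blocks.
by rewrite exchange_big.
Qed.

(** A product of equations acts as one rewriting rule that evaluates every [c5] before [ring]. *)
Let c5_table :
  ((c5 0 0 = 0) * (c5 0 1 = 1) * (c5 0 2 = 2) * (c5 0 3 = 2) * (c5 0 4 = 1) *
  (c5 1 0 = 1) * (c5 1 1 = 0) * (c5 1 2 = 1) * (c5 1 3 = 2) * (c5 1 4 = 2) *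
  (c5 2 0 = 2) * (c5 2 1 = 1) * (c5 2 2 = 0) * (c5 2 3 = 1) * (c5 2 4 = 2) *
  (c5 3 0 = 2) * (c5 3 1 = 2) * (c5 3 2 = 1) * (c5 3 3 = 0) * (c5 3 4 = 1) *
  (c5 4 0 = 1) * (c5 4 1 = 2) * (c5 4 2 = 2) * (c5 4 3 = 1) * (c5 4 4 = 0))%type.
Proof. by do ![split]. Qed.

(** The degrees of a block total [10 + a + b], and the distances from any vertex of a pentagon total
    [0 + 1 + 1 + 2 + 2 = 6]. An extra degree at the exit [U], or at offset [0] of the second block,
    meets distance zero inside its block. *)
Lemma cross_sum U V a b a' b' M : U < 5 -> V < 5 ->
  \sum_(0 <= l < 5) \sum_(0 <= r < 5)
    ((2 + a * (l == 0) + b * (l == U)) + (2 + a' * (r == 0) + b' * (r == V))) *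
    (c5 l U + 1 + M + c5 0 r) =
  5 * ((10 + a + b) + (10 + a' + b')) * (1 + M) + 5 * (12 + a * c5 0 U) +
  6 * (10 + a' + b') + 5 * (12 + b' * c5 0 V) + 6 * (10 + a + b).
Proof.
move=> U5 V5; rewrite !sum5E; move: U5 V5.
move=> /lt5P[->|->|->|[]->] /lt5P[->|->|->|[]->]; rewrite !c5_table /=; ring.
Qed.

(** The ten pairs of a pentagon have total distance [15] and degree sum [4] each; an extra degree at
    one vertex adds its total distance [6]. *)
Lemma block_sum U a b : U < 5 ->
  \sum_(0 <= l < 5) \sum_(0 <= r < 5) (l < r) *
    (((2 + a * (l == 0) + b * (l == U)) + (2 + a * (r == 0) + b * (r == U))) *
    c5 l r) = 60 + 6 * a + 6 * b.
Proof.
move=> U5; rewrite !sum5E; move: U5.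
move=> /lt5P[->|->|->|[]->]; rewrite !c5_table /=; ring.
Qed.

End SchultzIndex.

(** * The Schultz index as an affine function of the exit distances *)

Section SchultzAffine.
Local Open Scope nat_scope.
Implicit Types (u : nat -> 'I_5) (a b i j k l m n r : nat).

Lemma sum_lt (F : nat -> nat) n k : k <= n ->
  \sum_(0 <= i < n) (i < k) * F i = \sum_(0 <= i < k) F i.
Proof.
move=> kn; rewrite (@big_cat_nat _ _ _ k)//=.
rewrite [X in _ + X = _]big_nat_cond [X in _ + X = _]big1 ?addn0.
  by apply: eq_big_nat => i /andP[_ ->]; rewrite mul1n.
by move=> i /andP[/andP[ki _] _]; rewrite ltnNge ki.
Qed.

Lemma sum_gt (F : nat -> nat) n k : k < n ->
  \sum_(0 <= j < n) (k < j) * F j = \sum_(k.+1 <= j < n) F j.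
Proof.
move=> kn; rewrite (@big_cat_nat _ _ _ k.+1)//=.
rewrite [X in X + _ = _]big_nat_cond [X in X + _ = _]big1 ?add0n.
  by apply: eq_big_nat => j /andP[-> _]; rewrite mul1n.
by move=> j /andP[/andP[_ ki] _]; rewrite ltnNge -ltnS ki.
Qed.

(* Sum of the degrees of the five vertices of the block [i]. *)
Definition block_deg n i := 10 + (0 < i) + (i.+1 < n).

(** A block has degree total [12], except the first, which lacks one bridge; the term [0 < k]
    restores it. *)
Lemma block_deg_before n k : k < n ->
  \sum_(0 <= i < k) block_deg n i + (0 < k) = 12 * k.
Proof.
elim: k => [|k IH] kn; first by rewrite big_geq.
rewrite big_nat_recr//=; have := IH (ltnW kn); rewrite /block_deg kn; lia.
Qed.

Lemma block_deg_after n k : k < n ->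
  \sum_(k.+1 <= j < n) block_deg n j + (k.+1 < n) = 12 * (n - k.+1).
Proof.
case: n => // n; rewrite ltnS leq_eqVlt => /orP[/eqP ->|kn].
  by rewrite big_geq// ltnn subnn.
rewrite big_nat_recr//= /block_deg ltnn ltnS kn.
rewrite (@eq_big_nat _ _ _ _ _ _ (fun=> 12)).
  by rewrite sum_nat_const_nat; lia.
by move=> j /andP[kj jn]; rewrite ltnS jn; lia.
Qed.

Definition schultz_base_term n i j :=
  (i < j) * (5 * (block_deg n i + block_deg n j) * (1 + (j - i.+1)) + 120 +
             6 * (block_deg n i + block_deg n j)) +
  (i == j) * (60 + 6 * (0 < i) + 6 * (i.+1 < n)).

Definition schultz_var_term n u i j :=
  (i < j) * (5 * (block_deg n i + block_deg n j) *
      (\sum_(i.+1 <= k < j) c5 0 (u k.+1)) +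
    5 * ((0 < i) * c5 0 (u i.+1)) + 5 * ((j.+1 < n) * c5 0 (u j.+1))).

Lemma schultz_terms n u : schultz n u =
  \sum_(0 <= i < n) \sum_(0 <= j < n)
     (schultz_base_term n i j + schultz_var_term n u i j).
Proof.
rewrite schultz_blocks; apply: eq_big_nat => i /andP[_ iN].
apply: eq_big_nat => j /andP[_ jN].
rewrite /schultz_base_term /schultz_var_term.
have [ij|ji|<-] := ltngtP i j.
- rewrite addn0 !mul1n.
  under eq_big_nat => l /andP[_ l5].
    under eq_big_nat => r /andP[_ r5].
      rewrite (_ : 5 * i + l < 5 * j + r); last by lia.
      rewrite mul1n !pg_degE// pg_distE//; last exact: ltnW.
      rewrite /block_dist (ltn_eqF ij) ij /root_dist.
      over.
    over.
  rewrite cross_sum// big_split/= sum_nat_const_nat muln1 /block_deg.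
  set M := \sum_(_ <= _ < _) _; ring.
- rewrite !mul0n big_nat_cond big1// => l /andP[/andP[_ l5] _].
  rewrite big_nat_cond big1// => r /andP[/andP[_ r5] _].
  by rewrite (_ : 5 * i + l < 5 * j + r = false)//; lia.
- rewrite !mul0n mul1n add0n addn0 -(@block_sum (u i.+1))//.
  apply: eq_big_nat => l /andP[_ l5]; apply: eq_big_nat => r /andP[_ r5].
  by rewrite ltn_add2l !pg_degE// pg_distE// /block_dist eqxx.
Qed.

(** The exit distance of block [k] is met by the pairs [i < k < j], weighted by degree totals. The
    pairs with [k] as an endpoint supply the missing bridge ends, completing these totals to
    [12 * k] and [12 * (n - k.+1)]; hence [5 * (12 + 12) = 120]. *)
Lemma sum_var_terms n u :
  \sum_(0 <= i < n) \sum_(0 <= j < n) schultz_var_term n u i j =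
  120 * \sum_(0 <= k < n) k * (n - k.+1) * c5 0 (u k.+1).
Proof.
set y := fun k => c5 0 (u k.+1); pose A := block_deg n.
transitivity (\sum_(0 <= i < n) \sum_(0 <= j < n)
   (5 * \sum_(0 <= k < n) (i < k) * (k < j) * (A i + A j) * y k +
    5 * ((0 < i) * y i) * (i < j) + 5 * ((j.+1 < n) * y j) * (i < j))).
  apply: eq_big_nat => i /andP[_ iN]; apply: eq_big_nat => j /andP[_ jN].
  rewrite /schultz_var_term -/A -/(y i) -/(y j).
  have -> : \sum_(0 <= k < n) (i < k) * (k < j) * (A i + A j) * y k =
    (i < j) * (A i + A j) * \sum_(i.+1 <= k < j) y k.
    have [ij|ji] := ltnP i j; last first.
      rewrite big_nat_cond big1// => k /andP[/andP[_ kn] _].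
      rewrite (_ : (i < k) * (k < j) = 0)//.
      by case: (ltnP i k) => //= ik; rewrite (_ : k < j = false)//; lia.
    rewrite mul1n big_distrr/= -(sum_gt _ ij).
    rewrite -(sum_lt (fun k => (i < k) * ((A i + A j) * y k)) (ltnW jN)).
    by apply: eq_bigr => k _; ring.
  rewrite -/y; set M := \sum_(_ <= k < _) _; ring.
under eq_bigr do rewrite 2!big_split.
rewrite 2!big_split /=.
have -> : \sum_(0 <= i < n) \sum_(0 <= j < n)
    5 * (\sum_(0 <= k < n) (i < k) * (k < j) * (A i + A j) * y k) =
  \sum_(0 <= k < n) 5 * y k *
    ((\sum_(0 <= i < n) (i < k) * A i) * (\sum_(0 <= j < n) (k < j) * 1) +
     (\sum_(0 <= i < n) (i < k) * 1) * (\sum_(0 <= j < n) (k < j) * A j)).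
  under eq_bigr do under eq_bigr do rewrite big_distrr/=.
  under eq_bigr do rewrite exchange_big/=.
  rewrite exchange_big/=; apply: eq_bigr => k _.
  rewrite !big_distrlr/= -big_split/= big_distrr/=; apply: eq_bigr => i _.
  rewrite -big_split/= big_distrr/=; apply: eq_bigr => j _.
  ring.
have -> : \sum_(0 <= i < n) \sum_(0 <= j < n) 5 * ((0 < i) * y i) * (i < j) =
  \sum_(0 <= k < n) 5 * y k * ((0 < k) * \sum_(0 <= j < n) (k < j) * 1).
  apply: eq_bigr => k _; rewrite [in RHS]mulnA big_distrr/=; apply: eq_bigr => j _; ring.
have -> : \sum_(0 <= i < n) \sum_(0 <= j < n) 5 * ((j.+1 < n) * y j) * (i < j) =
  \sum_(0 <= k < n) 5 * y k * ((k.+1 < n) * \sum_(0 <= i < n) (i < k) * 1).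
  rewrite exchange_big/=; apply: eq_bigr => k _.
  rewrite [in RHS]mulnA big_distrr/=; apply: eq_bigr => j _; ring.
rewrite -2!big_split/= big_distrr/=; apply: eq_big_nat => k /andP[_ kn].
rewrite !sum_gt// !sum_lt//; try exact: ltnW.
rewrite !sum_nat_const_nat subn0 !muln1.
have := block_deg_before kn; have := block_deg_after kn.
rewrite -/A; set SL := \sum_(_ <= i < k) _; set SR := \sum_(_ <= j < n) _.
rewrite -/(y k) => hR hL.
transitivity (5 * y k * ((SL + (0 < k)) * (n - k.+1) + k * (SR + (k.+1 < n)))).
  ring.
rewrite hL hR; ring.
Qed.

Lemma schultzE n u : schultz n u =
  \sum_(0 <= i < n) \sum_(0 <= j < n) schultz_base_term n i j +
  120 * \sum_(0 <= k < n) k * (n - k.+1) * c5 0 (u k.+1).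
Proof.
rewrite schultz_terms -sum_var_terms -big_split/=.
by under eq_bigr do rewrite big_split/=.
Qed.

End SchultzAffine.

(** * The law of the Schultz index *)

Section SchultzLaw.
Context {R : realType} {d : measure_display} {T : measurableType d}.
Implicit Types (n m k : nat).

(** Here [m = k.+1] is the label of the pentagon [O_m], with [m - 1] pentagons before it and [n - m]
    after. *)
Definition schultz_weight n m : R := 120 * (m.-1 * (n - m))%:R.

(** Exit distances are [1] or [2]; all are set to [1] here, which leaves the indicator of distance
    [2] as the random part. *)
Definition schultz_min n : R :=
  (\sum_(0 <= i < n) \sum_(0 <= j < n) schultz_base_term n i j +
   120 * \sum_(0 <= k < n) k * (n - k.+1))%N%:R.

Lemma c5_root (a : 'I_5) : val a != 0%N ->
  c5 0 a = (1 + ~~ ((val a == 1) || (val a == 4)))%N.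
Proof. by case: a => -[|[|[|[|[|a]]]]] a5. Qed.

(** The weights vanish at both ends [m = 1] and [m = n]; what remains are labels [m >= 2], whose law
    is prescribed. *)
Lemma sum_inner_blocks (V : nmodType) (F : nat -> V) n : F 1%N = 0 -> F n = 0 ->
  \sum_(0 <= k < n) F k.+1 = \sum_(m <- index_iota 2 n) F m.
Proof.
move=> F1 Fn; case: n Fn => [|[|n]] Fn; first by rewrite big_geq ?[RHS]big_geq.
  by rewrite big_nat1 F1 big_geq.
by rewrite big_nat_recr//= Fn addr0 big_nat_recl//= F1 add0r !big_add1.
Qed.

Lemma SPG_failure_sum (u : nat -> T -> 'I_5) n w :
  (forall m w, (2 <= m)%N -> val (u m w) != 0%N) ->
  SPG R n u w =
  schultz_min n + failure_sum (Z1 u) (schultz_weight n) (index_iota 2 n) w.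
Proof.
move=> u0; rewrite /SPG schultzE /schultz_min.
have -> : (\sum_(0 <= k < n) k * (n - k.+1) * c5 0 (u k.+1 w) =
  \sum_(0 <= k < n) k * (n - k.+1) +
  \sum_(0 <= k < n) k * (n - k.+1) * ~~ Z1 u k.+1 w)%N.
  rewrite -big_split/=; apply: eq_bigr => -[|k] _; first by rewrite !mul0n.
  by rewrite c5_root ?u0// mulnDr muln1.
rewrite mulnDr addnA natrD; congr (_ + _).
rewrite /failure_sum natrM natr_sum mulr_sumr.
rewrite -(@sum_inner_blocks _ (fun m => schultz_weight n m * (~~ Z1 u m w)%:R)); last 2 first.
- by rewrite /schultz_weight mul0n mulr0 mul0r.
- by rewrite /schultz_weight subnn muln0 mulr0 mul0r.

by apply: eq_bigr => k _; rewrite /schultz_weight natrM mulrA.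
Qed.

(** The power sums of exponents 2, 3 and 4 in closed form; [x] is independent of [n] so that the
    induction goes through, and is set to [n - 1] afterwards. *)
Lemma sum_sqr_product (x : R) n :
  \sum_(0 <= k < n) (k%:R * (x - k%:R)) ^+ 2 =
  x ^+ 2 * ((n%:R - 1) * n%:R * (2 * n%:R - 1) / 6)
  - 2 * x * (n%:R * (n%:R - 1) / 2) ^+ 2
  + (n%:R - 1) * n%:R * (2 * n%:R - 1) * (3 * (n%:R - 1) ^+ 2 + 3 * (n%:R - 1) - 1) / 30.
Proof.
elim: n => [|n IH]; first by rewrite big_geq//; field.
by rewrite big_nat_recr//= IH -natr1; field.
Qed.

Lemma schultz_weight_sqr n : (0 < n)%N ->
  \sum_(m <- index_iota 2 n) schultz_weight n m ^+ 2 =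
  480 * ((n%:R - 1) ^+ 5 - (n%:R - 1)).
Proof.
move=> n0; rewrite -(@sum_inner_blocks _ (fun m => schultz_weight n m ^+ 2)); last 2 first.
- by rewrite /schultz_weight mul0n mulr0 expr0n.
- by rewrite /schultz_weight subnn muln0 mulr0 expr0n.
transitivity (14400 * \sum_(0 <= k < n) (k%:R * (n%:R - 1 - k%:R) : R) ^+ 2).
  rewrite mulr_sumr; apply: eq_big_nat => k /andP[_ kn].
  rewrite /schultz_weight /= natrM natrB// -natr1; ring.
by rewrite sum_sqr_product; field.
Qed.

(** As [360 - 240 = 233 - 113 = 120], the constants [sig2], [sig2t] and [r2] all equal
    [14400 * p1 * (1 - p1)], and the polynomial collapses to [(n - 1) ^ 5 - (n - 1)]. *)
Lemma var_formulaE (p1 : R) n : (0 < n)%N ->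
  var_formula p1 n =
  p1 * (1 - p1) * \sum_(m <- index_iota 2 n) schultz_weight n m ^+ 2.
Proof.
move=> n0; rewrite schultz_weight_sqr// /var_formula /sig2 /sig2t /r2; by field.
Qed.

Lemma schultz_weight_cube n :
  \sum_(m <- index_iota 2 n) schultz_weight n m ^+ 3 <=
  120 * n%:R ^+ 2 * \sum_(m <- index_iota 2 n) schultz_weight n m ^+ 2.
Proof.
rewrite mulr_sumr big_seq [leRHS]big_seq; apply: ler_sum => m.
rewrite mem_index_iota => /andP[_ mn].
rewrite exprS ler_wpM2r ?sqr_ge0// /schultz_weight ler_wpM2l//.
by rewrite -natrX ler_nat expnS expn1 leq_mul// ?leq_subr// (leq_trans (leq_pred m))// ltnW.
Qed.

Lemma schultz_weight_sqr_lower n : (2 < n)%N ->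
  n%:R ^+ 5 <= \sum_(m <- index_iota 2 n) schultz_weight n m ^+ 2.
Proof.
move=> n2; rewrite schultz_weight_sqr; last by rewrite (ltn_trans _ n2).
have n3 : 3 <= n%:R :> R by rewrite ler_nat.
set x : R := n%:R in n3 *.
(* With [y = x - 1], [y ^ 5 - y] factors as [y (y - 1) (y + 1) (y ^ 2 + 1)]; each factor is compared
   with a multiple of a power of [x], using [x >= 3]. *)
have h1 : x / 2 <= x - 1 by lra.
have h2 : x / 4 <= x - 2 by lra.
have h3 : (x / 2) ^+ 2 <= (x - 1) ^+ 2 + 1.
  by apply: (@le_trans _ _ ((x - 1) ^+ 2)); [rewrite lerXn2r ?nnegrE; lra|lra].
have h : x / 2 * (x / 4) * (x / 2) ^+ 2 <= (x - 1) * (x - 2) * ((x - 1) ^+ 2 + 1).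
  by rewrite ler_pM ?sqr_ge0 ?mulr_ge0 ?ler_pM; lra.
have -> : 480 * ((x - 1) ^+ 5 - (x - 1)) =
  480 * x * ((x - 1) * (x - 2) * ((x - 1) ^+ 2 + 1)) by ring.
have h' := ler_wpM2l (_ : 0 <= 480 * x) h.
have {}h' := h' ltac:(lra).
apply: le_trans h'.
have -> : 480 * x * (x / 2 * (x / 4) * (x / 2) ^+ 2) = 15 * x ^+ 5 by field.
have : 0 <= x ^+ 5 by rewrite exprn_ge0; lra.
lra.
Qed.

End SchultzLaw.

Theorem theorem3p2 (R : realType) (d : measure_display) (T : measurableType d)
    (P : probability T R) (u : nat -> T -> 'I_5) (p1 : R) :
  (* for n >= 2, u_n is not x_1 of O_n (u_1 is an arbitrary vertex of O_1) *)
  (forall m w, (2 <= m)%N -> val (u m w) != 0%N) ->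
  (forall m, (2 <= m)%N -> measurable [set w | Z1 u m w]) ->
  (forall m, (2 <= m)%N -> P [set w | Z1 u m w] = p1%:E) ->
  (* Hypothesis 1 *)
  indep_from2 P (Z1 u) ->
  (* Hypothesis 2 *)
  0 < p1 < 1 ->
  (forall n, (1 <= n)%N -> var_of P (SPG R n u) = (var_formula p1 n)%:E) /\
  ((fun n => kolm_dist P (SPG R n u)) @ \oo --> (0 : R^o)).
Proof.
move=> u0 mZ PZ iZ /andP[p0 p1_lt1].
have p0' := ltW p0; have p1' := ltW p1_lt1.
have q0 : 0 <= 1 - p1 by rewrite subr_ge0.
have pq1 : p1 + (1 - p1) = 1 by rewrite addrC subrK.
have pq0 : 0 < p1 * (1 - p1) by rewrite mulr_gt0// subr_gt0.
have SE n : SPG R n u = fun w => schultz_min n +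
    failure_sum (Z1 u) (schultz_weight n) (index_iota 2 n) w.
  by apply/funext => w; exact: SPG_failure_sum.
have min0 n : 0 <= schultz_min n :> R by rewrite /schultz_min.
have wt0 n m : 0 <= schultz_weight n m :> R by rewrite mulr_ge0.
have J2 n : all (fun m => 2 <= m)%N (index_iota 2 n).
  by apply/allP => m; rewrite mem_index_iota => /andP[].
have uJ n : uniq (index_iota 2 n) by exact: iota_uniq.
have varE n : var_of P (SPG R n u) =
    (p1 * (1 - p1) * \sum_(m <- index_iota 2 n) schultz_weight n m ^+ 2)%:E.
  by rewrite SE (var_failure_sum (p := p1)).
split=> [n n1|]; first by rewrite varE var_formulaE.
apply/cvgrPdist_le => e e0.
have e20 : 0 < e / 2 by rewrite divr_gt0.
have [K K0 HK] := bern_mean_clt e20.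
(* [K] may be zero, so [K + 1] is used as the divisor. *)
have K10 : 0 < K + 1 by rewrite ltr_wpDl.
(* Since [s ^ 2 = p1 (1 - p1) V], this choice makes the target [e / 2 / (K + 1) * s ^ 3] equal to
   [c * s * V]. *)
pose c : R := e / 2 / (K + 1) * (p1 * (1 - p1)).
have c0 : 0 < c by rewrite mulr_gt0// divr_gt0.
near=> n.
have n2 : (2 < n)%N by near: n; exact: nbhs_infty_gt.
have nc : 14400 / (c ^+ 2 * (p1 * (1 - p1))) <= n%:R.
  by near: n; exact: nbhs_infty_ger.
pose ws : seq R := map (schultz_weight n) (index_iota 2 n).
pose V : R := \sum_(m <- index_iota 2 n) schultz_weight n m ^+ 2.
pose s := Num.sqrt (p1 * (1 - p1) * V).
have n0 : 0 < n%:R :> R by rewrite ltr0n (ltn_trans _ n2).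
have Vn : n%:R ^+ 5 <= V by exact: schultz_weight_sqr_lower.
have V0 : 0 < V by apply: lt_le_trans Vn; rewrite exprn_gt0.
have s0 : 0 < s by rewrite sqrtr_gt0 mulr_gt0.
have s2 : s ^+ 2 = p1 * (1 - p1) * V by rewrite sqr_sqrtr// mulr_ge0// ltW.
have ws0 : all (fun v => 0 <= v) ws by apply/allP => _ /mapP[m _ ->].
have ratio : (\sum_(v <- ws) v ^+ 3) / s ^+ 3 <= e / 2 / (K + 1).
  rewrite ler_pdivrMr ?exprn_gt0// big_map.
  apply: (le_trans (schultz_weight_cube n)); rewrite -/V.
  (* After squaring, with [V >= n ^ 5], it suffices that [14400 * n ^ 4 <= c ^ 2 * p1 * (1 - p1) * n
     ^ 5], which is the threshold [nc]. *)
  have nS : 120 * n%:R ^+ 2 <= c * s.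
    rewrite -ler_sqr ?nnegrE; last 2 first.
    - by rewrite mulr_ge0// sqr_ge0.
    - by rewrite mulr_ge0// ltW.
    rewrite [leRHS]exprMn s2.
    have h : 14400 <= c ^+ 2 * (p1 * (1 - p1)) * n%:R.
      by rewrite mulrC -ler_pdivrMr// mulr_gt0// exprn_gt0.
    apply: (@le_trans _ _ (c ^+ 2 * (p1 * (1 - p1)) * n%:R * n%:R ^+ 4)).
      have -> : (120 * n%:R ^+ 2) ^+ 2 = 14400 * n%:R ^+ 4 :> R by ring.
      by rewrite ler_wpM2r// exprn_ge0.
    have -> : c ^+ 2 * (p1 * (1 - p1) * V) = c ^+ 2 * (p1 * (1 - p1)) * V by ring.
    by rewrite -mulrA -exprS ler_wpM2l// mulr_ge0// ?sqr_ge0// ltW.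
  have -> : e / 2 / (K + 1) * s ^+ 3 = c * s * V.
    by rewrite exprS s2 /c; ring.
  by rewrite ler_wpM2r// ltW.
have KR : K * ((\sum_(v <- ws) v ^+ 3) / s ^+ 3) <= e / 2.
  apply: (@le_trans _ _ (K * (e / 2 / (K + 1)))); first by rewrite ler_wpM2l.
  by rewrite mulrA ler_pdivrMr// mulrC ler_wpM2l ?lerDl// ltW.
rewrite sub0r normrN.
have /andP[k0 ke] : 0 <= kolm_dist P (SPG R n u) <= e.
  apply: kolm_dist_bound => a.
  rewrite varE /= -/V -/s.
  have -> : expect_of P (SPG R n u) =
     (schultz_min n + (1 - p1) * \sum_(v <- ws) v)%:E.
    by rewrite SE (expect_failure_sum (p := p1))// big_map.
  rewrite SE /= (cdf_failure_sum (p := p1))//= -/ws.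
  have := HK p1 (1 - p1) ws (schultz_min n) a p0' q0 pq1.
  have -> : \sum_(w <- ws) w ^+ 2 = V by rewrite big_map.
  move=> /(_ s0 ws0) /le_trans; apply.
  by rewrite -/s [leRHS]splitr lerD2l.
by rewrite ger0_norm.
Unshelve. all: by end_near.
Qed.
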